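(* Let $[\widehat{0},\widehat{1}]$ be a graded dual simplicial Eulerian poset of rank $n+1$ and let $(h_0,\ldots,h_n)$ be the toric $h$-vector of $(\widehat{0},\widehat{1}]^*$. Then $$ g([\widehat{0},\widehat{1}),x)=h_0+\sum_{i=1}^{\left\lfloor n/2\right\rfloor} (h_i-h_{i-1}) \sum_{k=1}^{\min\{i,n-i\}} \frac{n+1-2i}{k}\binom{n-i}{k-1}\binom{i-1}{k-1}\,x^k. $$
   Context: A graded poset is a finite poset with a unique minimum $\widehat{0}$, a unique maximum $\widehat{1}$ and a rank function $\rho:P\to\mathbb{N}$ with $\rho(\widehat{0})=0$ and $\rho(y)=\rho(x)+1$ whenever $y$ covers $x$; its rank is $\rho(\widehat{1})$. It is Eulerian if $\sum_{z\in[u,v]}(-1)^{\rho(z)}=0$ for all $u<v$. It is dual simplicial if for every $t\neq\widehat{0}$ the interval $[t,\widehat{1}]$ is a Boolean algebra. $Q^*$ denotes the dual (order-reversed) poset of $Q$. Write $[\widehat{0},p)=\{q: q<p\}$ and $(\widehat{0},\widehat{1}]=[\widehat{0},\widehat{1}]\setminus\{\widehat{0}\}$. Stanley's toric polynomials: $f(\emptyset,x)=g(\emptyset,x)=1$ ($\emptyset$ being $[\widehat{0},\widehat{1})$ for the Eulerian poset of rank $0$), and for an Eulerian poset of rank at least $1$, $$f([\widehat{0},\widehat{1}),x)=\sum_{p\in[\widehat{0},\widehat{1})} g([\widehat{0},p),x)(x-1)^{\rho(\widehat{1})-1-\rho(p)},$$ $$g([\widehat{0},\widehat{1}),x)=\sum_{i=0}^{\lfloor(\rho(\widehat{1})-1)/2\rfloor}\left([x^i]f([\widehat{0},\widehat{1}),x)-[x^{i-1}]f([\widehat{0},\widehat{1}),x)\right)x^i.$$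 Toric $h$-vector: for an Eulerian poset $Q$ of rank $n+1$, the toric $h$-vector $(h_0,\dots,h_n)$ of $Q\setminus\{\widehat{1}_Q\}$ is defined by $\sum_i h_ix^i=x^nf(Q\setminus\{\widehat{1}_Q\},1/x)$ (which, by a theorem of Stanley, equals $f(Q\setminus\{\widehat{1}_Q\},x)$). Here it is applied to $Q=[\widehat{0},\widehat{1}]^*$, whose maximum is $\widehat{0}$. *)

(* Defs.v *)
From HB Require Import structures.
From mathcomp Require Import all_boot all_order all_algebra.

Set Implicit Arguments.
Unset Strict Implicit.
Unset Printing Implicit Defensive.

Import Order.TTheory GRing.Theory Num.Theory.
Local Open Scope ring_scope.
Local Open Scope order_scope.

Section GradedPosets.
Variables (d : Order.disp_t) (P : finTBPOrderType d).
Implicit Types (rho : P -> nat) (x y u v p q : P).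

Definition covers x y : bool := (x < y) && ~~ [exists z, x < z < y].

Definition is_rank rho : Prop :=
  rho \bot = 0%N /\ (forall x y, covers x y -> rho y = (rho x).+1).

Definition eulerian rho : Prop :=
  forall u v, u < v -> \sum_(z | u <= z <= v) (-1) ^+ rho z = 0 :> int.

(* [u, v] is isomorphic to the poset of all subsets of a k-element set. *)
Definition boolean_interval u v : Prop :=
  exists (k : nat) (f : {set 'I_k} -> P),
    [/\ forall A, u <= f A <= v,
        forall x, u <= x <= v -> exists A, f A = x
      & forall A B, (f A <= f B) = (A \subset B)].

Definition dual_simplicial : Prop :=
  forall t, t != \bot -> boolean_interval t \top.

Definition g_of_f (r : nat) (f : {poly rat}) : {poly rat} :=
  \poly_(i < (r.-1)./2.+1) (f`_i - (if i is j.+1 then f`_j else 0)).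

(* The number of elements below p is enough fuel for the recursion, so the
   fuel never runs out: see toric_gE. *)
Fixpoint toric_g_rec rho (fuel : nat) p : {poly rat} :=
  if p == \bot then 1 else
  if fuel is k.+1 then
    g_of_f (rho p)
      (\sum_(q | q < p) toric_g_rec rho k q * ('X - 1) ^+ (rho p - 1 - rho q))
  else 0.

(* toric_f rho p and toric_g rho p are f([0, p), x) and g([0, p), x), the
   interval [0, p] being graded by the restriction of rho. *)
Definition toric_g rho p : {poly rat} :=
  toric_g_rec rho #|[set q | (q < p)%O]| p.

Definition toric_f rho p : {poly rat} :=
  if p == \bot then 1 else
  \sum_(q | q < p) toric_g rho q * ('X - 1) ^+ (rho p - 1 - rho q).

(* The coefficients of x^n f(P \ {1}, 1/x), where n + 1 is the rank of P and
   f(P \ {1}, x) has degree at most n by size_toric_f. *)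
Definition toric_h rho (i : nat) : rat :=
  let n := (rho \top).-1 in
  if (i <= n)%N then (toric_f rho \top)`_(n - i) else 0.

Lemma toric_g_recE rho k p : (#|[set q | (q < p)%O]| <= k)%N ->
  toric_g_rec rho k p = toric_g rho p.
Proof.
rewrite /toric_g; move: {2 4}#|_| (leqnn #|[set q | (q < p)%O]|) => l.
elim: k l p => [|k IH] l p lel lek.
  case: l lel => [|l] _ //=; case: eqVneq => // p0; move: lek.
  by rewrite leqn0 cards_eq0 => /eqP/setP/(_ \bot); rewrite !inE lt0x p0.
have sub q : q < p -> (#|[set z | (z < q)%O]| < #|[set z | (z < p)%O]|)%N.
  move=> qp; apply/proper_card/properP; split; last first.
    by exists q; rewrite !inE ?ltxx.
  by apply/subsetP=> z; rewrite !inE => /lt_trans; apply.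
case: l lel => [|l] lel /=; case: eqVneq => // p0.
  by move: lel; rewrite leqn0 cards_eq0 => /eqP/setP/(_ \bot); rewrite !inE lt0x p0.
congr g_of_f; apply: eq_bigr => q qp; congr (_ * _).
by apply: IH; rewrite -ltnS; apply: leq_trans (sub _ qp) _.
Qed.

Lemma toric_g0 rho : toric_g rho \bot = 1.
Proof. by rewrite /toric_g; case: #|_| => [|k] /=; rewrite eqxx. Qed.

Lemma toric_gE rho p : p != \bot ->
  toric_g rho p = g_of_f (rho p) (toric_f rho p).
Proof.
move=> p0; rewrite -(@toric_g_recE rho #|[set q | (q < p)%O]|.+1) ?leqnSn //=.
rewrite /toric_f (negPf p0); congr g_of_f; apply: eq_bigr => q qp.
congr (_ * _); apply: toric_g_recE; apply/subset_leq_card/subsetP=> z.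
by rewrite !inE => /lt_trans; apply.
Qed.

Lemma rank_lt rho x y : is_rank rho -> x < y -> (rho x < rho y)%N.
Proof.
case=> _ cov; have [m] := ubnP #|[set z | (x < z < y)%O]|.
elim: m x y => // m IH x y lem xy.
case: (boolP (covers x y)) => [/cov-> //|].
rewrite /covers xy /= negbK => /existsP[z /andP[xz zy]].
have sub (A B : {set P}) : A \subset B -> z \in B -> z \notin A ->
    (#|B| < m.+1)%N -> (#|A| < m)%N.
  move=> AB zB zA; rewrite ltnS; apply: leq_trans.
  by apply/proper_card/properP; split=> //; exists z.
have z_in : z \in [set z | x < z < y] by rewrite inE xz.
apply: (@ltn_trans (rho z)); apply: IH => //; apply: sub z_in _ lem.
- apply/subsetP=> t; rewrite !inE => /andP[-> tz]; exact: lt_trans zy.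
- by rewrite inE ltxx andbF.
- apply/subsetP=> t; rewrite !inE => /andP[zt ->]; rewrite andbT.
  exact: lt_trans zt.
- by rewrite inE ltxx.
Qed.

Lemma size_toric_f rho p : is_rank rho -> p != \bot ->
  (size (toric_f rho p) <= rho p)%N.
Proof.
move=> rk p0; rewrite /toric_f (negPf p0).
apply: (leq_trans (size_sum _ _ _)); apply/bigmax_leqP => q qp.
have rqp := rank_lt rk qp.
apply: leq_trans (size_polyMleq _ _) _.
have -> : size (('X - 1 : {poly rat}) ^+ (rho p - 1 - rho q))
          = (rho p - 1 - rho q).+1.
  by rewrite size_exp_XsubC.
rewrite addnS /=.
have szg : (size (toric_g rho q) <= (rho q).+1)%N.
  have [->|q0] := eqVneq q \bot; first by rewrite toric_g0 size_poly1.
  rewrite toric_gE //; apply: leq_trans (size_poly _ _) _.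
  rewrite ltnS; apply: leq_trans (leq_pred _).
  by rewrite -{2}[_.-1]odd_double_half -addnn addnA leq_addl.
apply: leq_trans (leq_add szg (leqnn _)) _.
by rewrite addSn -subnDA add1n -addSn subnKC.
Qed.

End GradedPosets.

Definition dual_rank (d : Order.disp_t) (P : finTBPOrderType d)
    (rho : P -> nat) : P^d -> nat :=
  fun x => (rho \top - rho x)%N.

Lemma is_rank_dual (d : Order.disp_t) (P : finTBPOrderType d)
    (rho : P -> nat) : is_rank rho -> is_rank (dual_rank rho).
Proof.
move=> rk; split; first by rewrite /dual_rank subnn.
move=> x y /andP[xy nz]; rewrite /dual_rank.
have yx : (y : P) < (x : P) by [].
have -> : rho x = (rho y).+1.
  apply: rk.2; rewrite /covers yx /=; apply: contra nz.
  by case/existsP=> z /andP[yz zx]; apply/existsP; exists z; apply/andP.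
have lt_top : (rho y < rho \top)%N.
  by apply: (rank_lt rk); apply: (@lt_le_trans _ P x) => //; apply: (@lex1 _ P).
by rewrite subnSK.
Qed.

(* Main.v *)
From HB Require Import structures.
Require Import Defs.
From mathcomp Require Import all_boot all_order all_algebra.
From mathcomp Require Import ring zify.
Set Implicit Arguments.
Unset Strict Implicit.
Unset Printing Implicit Defensive.
Import Order.TTheory GRing.Theory Num.Theory.
Local Open Scope order_scope.
Local Open Scope ring_scope.

(* Write [m] for the rank of [p] and [s = x - 1]. If the polynomials [G p]
   satisfy [G 0 = 1], [deg (G p) <= (m - 1) / 2] and
   [\sum_(r <= p) (G r) s^(m - rho r) = x^m (G p)(1/x)], then
   [(1 - x) f([0, p), x) = G p - x^m (G p)(1/x)] by induction, and truncating
   gives [g([0, p), x) = G p].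

   For the candidate, let [d_i] be the coefficient of [x^i] in
   [\sum_(0 < q <= p) s^(rho q)], i.e. [h_(i-1) - h_i], and put
     [G p = 1 - \sum_(0 < i < m) d_i [z] (1 + x z)^(m-1-i) (1 + 1/z)^(i-1)].
   With [y = 1 + 1/z] and [w = 1 + x z], this is, up to an explicit term
   depending on [m] only, the sum over [0 < q <= p] of
   [- [z] (y - w)^(rho q) w^(m - rho q) / (y w)]. The required identity then
   holds term by term: the Boolean intervals [[q, p]] turn the left-hand sum
   into [(w + s)^(m - rho q)], and [x -> 1/x], [z -> x z] replaces [w] by
   [w + s] while preserving [y - w] and [y w].

   The Dehn-Sommerville relations [d_i = - d_(m - i)] fold the sum defining
   [G p] onto [1 <= i <= n / 2], which gives the stated coefficients. *)

(** * Ranks and weighted sums in Boolean intervals *)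

Section BooleanIntervals.
Variables (d : Order.disp_t) (P : finTBPOrderType d) (rho : P -> nat).
Hypotheses (rk : is_rank rho) (bool_up : dual_simplicial P).
Implicit Types p q r : P.

Lemma rank_le q p : (q <= p)%O -> (rho q <= rho p)%N.
Proof.
by rewrite le_eqVlt => /orP[/eqP->//|/(rank_lt rk)/ltnW].
Qed.

Lemma rank_gt0 p : (0 < rho p)%N = (p != \bot%O).
Proof.
have [->|p0] := eqVneq p \bot%O; first by rewrite rk.1.
by rewrite -rk.1 (rank_lt rk) // lt0x.
Qed.

(** No set lies strictly between [A :\ a] and [A], so removing one element goes down exactly one
    cover. *)
Lemma rank_boolean q k (f : {set 'I_k} -> P) A :
  (forall B, (q <= f B)%O) -> (forall r, (q <= r)%O -> exists B, f B = r) ->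
  (forall B C, (f B <= f C)%O = (B \subset C)) -> rho (f A) = (rho q + #|A|)%N.
Proof.
move=> lef surj fle.
have [m] := ubnP #|A|; elim: m A => // m IH A ltA.
have [->|[a aA]] := set_0Vmem A.
  rewrite cards0 addn0; congr rho; apply/le_anti; rewrite lef andbT.
  by have [B <-] := surj q (lexx _); rewrite fle sub0set.
have cA : #|A| = (#|A :\ a|).+1 by rewrite [LHS](cardsD1 a) aA.
rewrite cA addnS -IH; last by rewrite -ltnS -cA.
apply: rk.2; apply/andP; split.
  by rewrite lt_leAnge !fle subD1set; apply/subsetPn; exists a; rewrite ?inE ?eqxx.
apply/existsP=> -[z /andP[Az zA]].
have [C defC] := surj z (le_trans (lef _) (ltW Az)).
move: Az zA; rewrite -defC !lt_leAnge !fle -!properE.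
by move=> /proper_card + /proper_card; rewrite cA; lia.
Qed.

(** The isomorphism turns the interval into the subsets of one set; grouping them by cardinality
    gives the binomial theorem. *)
Lemma sum_boolean (R : comNzRingType) (a b : R) q p :
  q != \bot%O -> (q <= p)%O ->
  \sum_(r | (q <= r <= p)%O) a ^+ (rho p - rho r) * b ^+ (rho r - rho q)
    = (a + b) ^+ (rho p - rho q).
Proof.
move=> q0 qp; have [k [f [f_in f_surj fle]]] := bool_up q0.
have lef B : (q <= f B)%O by case/andP: (f_in B).
have surj r : (q <= r)%O -> exists B, f B = r.
  by move=> qr; apply: f_surj; rewrite qr lex1.
have rkf A := rank_boolean A lef surj fle.
have [A defp] := surj p qp.
have inj_f : injective f.
  by move=> B C fBC; apply/eqP; rewrite eqEsubset -!fle fBC lexx.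
rewrite -big_set /=.
have -> : [set r | (q <= r <= p)%O] = f @: powerset A.
  apply/setP=> r; rewrite inE; apply/andP/imsetP => [[qr rp]|[B + ->]].
    have [B defr] := surj r qr; exists B => //.
    by rewrite powersetE -fle defp defr.
  by rewrite powersetE -fle defp lef.
rewrite big_imset /=; last by move=> B C _ _; apply: inj_f.
rewrite -defp rkf addKn exprDn.
rewrite (partition_big (fun B : {set 'I_k} => inord #|B| : 'I_#|A|.+1) predT) //=.
apply: eq_bigr => i _; rewrite -cards_draws -sumr_const.
have cardE (B : {set 'I_k}) : (B \in powerset A) && (inord #|B| == i) =
    (B \in [set B : {set 'I_k} | (B \subset A) && (#|B| == i)]).
  rewrite powersetE inE; case BA: (B \subset A) => //=.
  by rewrite -val_eqE /= inordK // ltnS subset_leq_card.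
rewrite (eq_bigl _ _ cardE); apply: eq_bigr => B.
by rewrite inE => /andP[_ /eqP cB]; rewrite !rkf cB addKn subnDl.
Qed.

End BooleanIntervals.

(** * Truncation and reversal of polynomials *)

(** The coefficients of (1 - x) f are the differences that [g_of_f] truncates; [G] fits below the
    cut and [R] starts above it. *)
Lemma g_of_f_uniq r (f G R : {poly rat}) :
  (1 - 'X) * f = G - R -> (size G <= r.-1./2.+1)%N ->
  (forall i, (i <= r.-1./2)%N -> R`_i = 0) -> g_of_f r f = G.
Proof.
move=> eqf szG R0; apply/polyP=> i; rewrite coef_poly ltnS.
case: leqP => [le_i|lt_i]; last by rewrite nth_default // (leq_trans szG).
have := congr1 (fun p : {poly rat} => p`_i) eqf.
rewrite /= mulrBl mul1r !coefB coefXM R0 // subr0 => <-.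
by case: i {le_i}.
Qed.

Section Rev.
Variable R : comNzRingType.
Implicit Types p q : {poly R}.

(* [x ^ m * p(1/x)], when the degree of [p] is at most [m]. *)
Definition revp m p : {poly R} := \poly_(i < m.+1) p`_(m - i).

Fact revp_is_linear m : linear (revp m).
Proof.
move=> a p q; apply/polyP=> i; rewrite coefD coefZ !coef_poly.
by case: ifP => _; rewrite ?coefD ?coefZ // mulr0 addr0.
Qed.
HB.instance Definition _ m :=
  GRing.isLinear.Build R {poly R} {poly R} _ (revp m) (revp_is_linear m).

Lemma revpXn m k : (k <= m)%N -> revp m 'X^k = 'X^(m - k).
Proof.
move=> le_km; apply/polyP=> i; rewrite coef_poly !coefXn ltnS.
case: leqP => [le_im|lt_mi]; last by case: eqP => // ?; lia.
by congr (nat_of_bool _)%:R; apply/eqP/eqP; lia.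
Qed.

Lemma revpM a b p q : (size p <= a.+1)%N -> (size q <= b.+1)%N ->
  revp (a + b) (p * q) = revp a p * revp b q.
Proof.
move=> sp sq.
have widen c (t : {poly R}) : (size t <= c.+1)%N ->
    t = \sum_(i < c.+1) t`_i *: 'X^i.
  move=> st; rewrite -poly_def; apply/polyP=> i; rewrite coef_poly.
  by case: ltnP => // lei; rewrite nth_default // (leq_trans st).
rewrite (widen a p sp) (widen b q sq).
rewrite !linear_sum !mulr_suml !linear_sum; apply: eq_bigr => i _ /=.
rewrite !mulr_sumr linear_sum; apply: eq_bigr => j _ /=.
have hi := ltn_ord i; have hj := ltn_ord j.
rewrite -scalerAl -scalerAr -exprD !linearZ /= !revpXn; try lia.
rewrite -scalerAl -scalerAr -exprD; congr (_ *: (_ *: _)).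
by congr ('X^_); lia.
Qed.
End Rev.

(** * Coefficients of series divided by (1 + z)(1 + x z) *)

Section Series.
Variable R : comNzRingType.
Implicit Types (A B C : {poly {poly R}}).

Lemma coefM_trunc (T : comNzRingType) K (p q r : {poly T}) i :
  (forall l, (l < K)%N -> q`_l = r`_l) -> (i < K)%N -> (p * q)`_i = (p * r)`_i.
Proof.
move=> eqqr ltiK; rewrite !coefM; apply: eq_bigr => l _.
by rewrite eqqr // (leq_ltn_trans _ ltiK) ?leq_subr.
Qed.

(* The coefficient of [z ^ l] in the power series [1 / ((1 + z) (1 + x z))]. *)
Definition sigma l : {poly R} := (-1) ^+ l * \sum_(t < l.+1) 'X^t.

Lemma sigma0 : sigma 0 = 1.
Proof. by rewrite /sigma big_ord1 !expr0 mulr1. Qed.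

Lemma sigmaS l : sigma l.+1 + sigma l = (- 'X) ^+ l.+1.
Proof.
by rewrite /sigma big_ord_recr /= (exprNn 'X) (exprS (- 1)) mulN1r; ring.
Qed.

Lemma revp_sigma l : revp l (sigma l) = sigma l.
Proof.
rewrite /sigma -signr_odd; have -> b : (-1) ^+ b = ((-1) ^+ b)%:P :> {poly R}.
  by rewrite polyC_exp polyCN polyC1.
rewrite mul_polyC linearZ /= linear_sum (reindex_inj rev_ord_inj) /=.
congr (_ *: _); apply: eq_bigr => i _.
by rewrite revpXn ?subSS ?leq_subr // subKn // -ltnS.
Qed.

Lemma size_sigma l : (size (sigma l) <= l.+1)%N.
Proof.
rewrite /sigma -signr_odd; have -> b : (-1) ^+ b = ((-1) ^+ b)%:P :> {poly R}.
  by rewrite polyC_exp polyCN polyC1.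
rewrite mul_polyC (leq_trans (size_scale_leq _ _)) //.
apply: (leq_trans (size_sum _ _ _)); apply/bigmax_leqP => i _.
by rewrite size_polyXn.
Qed.

(* The indeterminate [x] is ['X%:P] and [z] is ['X]. *)
Definition zx : {poly {poly R}} := 'X%:P * 'X.

Definition ser K : {poly {poly R}} := \poly_(l < K) sigma l.

Lemma coef_ser K l : (l < K)%N -> ((1 + 'X) * ser K)`_l = (- 'X) ^+ l.
Proof.
move=> ltlK; rewrite mulrDl mul1r coefD coefXM !coef_poly ltlK.
case: l ltlK => [|l] ltlK /=; first by rewrite addr0 sigma0 expr0.
by rewrite ltnW // sigmaS.
Qed.

Lemma coef_ser1 K l : (l < K)%N ->
  ((1 + zx) * ((1 + 'X) * ser K))`_l = (1 : {poly {poly R}})`_l.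
Proof.
move=> ltlK; rewrite mulrDl mul1r coefD -mulrA coefCM coefXM coef_ser // coef1.
case: l ltlK => [|l] ltlK /=; first by rewrite mulr0 addr0.
by rewrite coef_ser ?(ltnW ltlK) // exprS mulNr addNr.
Qed.

(* The coefficient of [z ^ i] in the power series [A / ((1 + z) (1 + x z))],
   provided that [i < K]. *)
Definition lam K i A := (A * ser K)`_i.

Fact lam_is_linear K i : scalar (lam K i).
Proof. by move=> a A B; rewrite /lam mulrDl -scalerAl coefD coefZ. Qed.
HB.instance Definition _ K i :=
  GRing.isLinear.Build {poly R} {poly {poly R}} {poly R} *%R (lam K i) (lam_is_linear K i).

Lemma lam_cancel K i A : (i < K)%N ->
  lam K i ((1 + 'X) * (1 + zx) * A) = A`_i.
Proof.
move=> ltiK; rewrite /lam.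
have -> : (1 + 'X) * (1 + zx) * A * ser K = A * ((1 + zx) * ((1 + 'X) * ser K)).
  by ring.
by rewrite (coefM_trunc A (@coef_ser1 K)) // mulr1.
Qed.

Lemma lamXnM K i k A : lam K i ('X^k * A) = if (i < k)%N then 0 else lam K (i - k) A.
Proof. by rewrite /lam -mulrA coefXnM. Qed.

Lemma lam0 K m : (0 < K)%N -> lam K 0 ((1 + zx) ^+ m) = 1.
Proof.
move=> K0; rewrite /lam coef0M coef_poly K0 sigma0 mulr1 -horner_coef0.
by rewrite horner_exp !hornerE expr1n.
Qed.

(** Cancelling 1 + z leaves the coefficient of z^(m+1) in (1 + z)^m / (1 + x z), a binomial sum. It
    supplies the explicit term of [closed_gE]. *)
Lemma lam_diag K m : (m.+1 < K)%N ->
  lam K m.+1 ((1 + 'X) ^+ m.+1) = - 'X * (1 - 'X) ^+ m.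
Proof.
move=> ltmK; rewrite /lam exprSr -mulrA.
pose V : {poly {poly R}} := \poly_(l < K) (- 'X) ^+ l.
rewrite (@coefM_trunc _ K _ _ V) //; last first.
  by move=> l ltlK; rewrite coef_ser // coef_poly ltlK.
rewrite coefM big_ord_recr /= exprDn.
have cf i : (\sum_(i < m.+1) (1 ^+ (m - i) * 'X^i) *+ 'C(m, i) : {poly {poly R}})`_i
   = 'C(m, i)%:R.
  have [ltim|lemi] := ltnP i m.+1.
    rewrite coef_sum (bigD1 (Ordinal ltim)) //= big1 ?addr0 => [|j /eqP nji].
      by rewrite expr1n mul1r coefMn coefXn eqxx.
    rewrite expr1n mul1r coefMn coefXn; case: eqP => [eij|]; last by rewrite mul0rn.
    by case: nji; apply: val_inj.
  rewrite coef_sum big1 ?bin_small // => j _.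
  rewrite expr1n mul1r coefMn coefXn; case: eqP => [eij|]; last by rewrite mul0rn.
  by have := ltn_ord j; lia.
rewrite cf bin_small // mul0r addr0 -[1 - 'X]addrC exprDn mulr_sumr.
apply: eq_bigr => i _; rewrite cf coef_poly (leq_ltn_trans (leq_subr _ _)) //.
by rewrite subSn -1?ltnS // expr1n mulr1 exprS mulr_natl mulrnAr.
Qed.
End Series.

(** * Narayana-type coefficients and the contribution of a single element *)

Section ToricTerms.
Variable R : comNzRingType.

Lemma coef_exp_linear (T : comNzRingType) (c e : T) b i :
  ((c%:P + e%:P * 'X) ^+ b)`_i = (c ^+ (b - i) * e ^+ i) *+ 'C(b, i).
Proof.
have cf (l : nat) : (c%:P ^+ (b - l) * (e%:P * 'X) ^+ l *+ 'C(b, l))`_i =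
    if i == l then (c ^+ (b - l) * e ^+ l) *+ 'C(b, l) else 0.
  rewrite coefMn exprMn -!polyC_exp mulrA -polyCM coefCM coefXn.
  by case: eqP; rewrite ?mulr1 // mulr0 mul0rn.
rewrite exprDn coef_sum; under eq_bigr do rewrite cf.
have [ltib|lebi] := ltnP i b.+1.
  rewrite (bigD1 (Ordinal ltib)) //= eqxx big1 ?addr0 // => l /eqP nli.
  by case: eqP => // eil; case: nli; apply: val_inj.
rewrite bin_small // mulr0n big1 // => l _.
by case: eqP => // eil; have := ltn_ord l; lia.
Qed.

Lemma coef_expXB1 b i :
  (('X - 1 : {poly R}) ^+ b)`_i = (-1) ^+ (b - i) *+ 'C(b, i).
Proof.
have -> : 'X - 1 = (-1)%:P + 1%:P * 'X :> {poly R} by rewrite polyCN; ring.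
by rewrite coef_exp_linear expr1n mulr1.
Qed.

(** This is [z] (1 + x z)^a (1 + 1/z)^b, with negative powers of z cleared by the factor z^b. *)
Definition narayana a b : {poly R} := ((1 + zx R) ^+ a * (1 + 'X) ^+ b)`_b.+1.

Lemma coef_narayana a b k : (narayana a b)`_k =
  if k is k'.+1 then ('C(a, k) * 'C(b, k'))%:R else 0.
Proof.
have cf (l : nat) : (((1 + zx R) ^+ a)`_l * ((1 + 'X) ^+ b)`_(b.+1 - l))`_k =
    if k == l then ('C(a, l) * 'C(b, b.+1 - l))%:R else 0.
  have -> : 1 + 'X = 1%:P + 1%:P * 'X :> {poly {poly R}} by ring.
  rewrite /zx -polyC1 !coef_exp_linear !expr1n !mul1r mulr_natr -mulrnA coefMn.
  by rewrite coefXn natrM; case: eqP; rewrite ?mul0rn // -natrM.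
rewrite /narayana coefM coef_sum; under eq_bigr do rewrite cf.
have [ltkb|lebk] := ltnP k b.+2.
  rewrite (bigD1 (Ordinal ltkb)) //= eqxx big1 ?addr0 => [|l /eqP nlk]; last first.
    by case: eqP => // ekl; case: nlk; apply: val_inj.
  case: k ltkb {cf} => [|k] ltkb; first by rewrite ['C(b, _)]bin_small // muln0.
  by rewrite subSS bin_sub.
rewrite big1 => [|l _]; last by case: eqP => // ekl; have := ltn_ord l; lia.
by case: k lebk {cf} => // k lebk; rewrite ['C(b, _)]bin_small // muln0.
Qed.

Lemma size_narayana a b : (size (narayana a b) <= (minn a b.+1).+1)%N.
Proof.
apply/leq_sizeP => [[|k]]; rewrite // coef_narayana ltnS geq_min => h.
case/orP: h => h; first by rewrite bin_small.
by rewrite ['C(b, _)]bin_small ?muln0.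
Qed.

(** Since y - w = (1 - x z^2) / z and 1/y = z / (1 + z), this is [z] (y - w)^j w^(m-j) / (y w) when
    j < K. *)
Definition toricT K m j := lam K j ((1 - 'X * zx R) ^+ j * (1 + zx R) ^+ (m - j)).

(** Expanding (y - w)^j in powers of y and w produces the coefficients of (x - 1)^j, so that summing
    over q will collect those of [diff_h]. *)
Lemma toricT_expand K m j : (j <= m)%N -> (j < K)%N ->
  toricT K m j =
    \sum_(i < m.+1) ((('X - 1) ^+ j)`_i)%:P * lam K i ((1 + 'X) ^+ i * (1 + zx R) ^+ (m - i)).
Proof.
move=> lejm ltjK; rewrite /toricT.
have -> : 1 - 'X * zx R = (- ('X * (1 + zx R))) + (1 + 'X) by ring.
rewrite exprDn mulr_suml linear_sum /=.
pose G i := lam K j ((- ('X * (1 + zx R))) ^+ (j - i) * (1 + 'X) ^+ i *+ 'C(j, i)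
                      * (1 + zx R) ^+ (m - j)).
rewrite (big_ord_widen m.+1 G) // big_mkcond; apply: eq_bigr => i _ /=.
rewrite coef_expXB1 {}/G.
case: ltnP => [leij|ltji]; last by rewrite bin_small // mulr0n mul0r.
rewrite (exprNn ('X * _)) exprMn polyCMn.
have -> : (-1) ^+ (j - i) = ((-1) ^+ (j - i))%:P%:P :> {poly {poly R}}.
  by rewrite !polyC_exp !polyCN.
have -> : (((-1) ^+ (j - i))%:P%:P * ('X^(j - i) * (1 + zx R) ^+ (j - i)) *
     (1 + 'X) ^+ i *+ 'C(j, i) * (1 + zx R) ^+ (m - j)) =
   ((-1) ^+ (j - i))%:P *: ('X^(j - i) * ((1 + 'X) ^+ i * (1 + zx R) ^+ (m - i)))
     *+ 'C(j, i).
  have -> : (m - i = (j - i) + (m - j))%N by lia.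
  by rewrite exprD -mul_polyC; ring.
rewrite linearMn linearZ /= lamXnM -mulrnAl; case: ltnP; first by lia.
by rewrite subKn.
Qed.

(** The constant [c] stays free because c = 1 gives [toricT] and c = x its reversal. *)
Lemma lam_pow_expand K j e (c : {poly R}) : (j < K)%N ->
  lam K j ((1 - 'X * zx R) ^+ j * (c%:P + zx R) ^+ e) =
  \sum_(b < j.+1) \sum_(l < e.+1)
    if (j < b.*2 + l)%N then 0 else
    ((-1) ^+ b *+ 'C(j, b) *+ 'C(e, l))%:P * (c ^+ (e - l) * 'X^(b + l) * sigma R (j - (b.*2 + l))).
Proof.
move=> ltjK; rewrite exprDn mulr_suml linear_sum /=; apply: eq_bigr => b _.
rewrite exprDn mulr_sumr linear_sum /=; apply: eq_bigr => l _.
have -> : 1 ^+ (j - b) * (- ('X * zx R)) ^+ b *+ 'C(j, b) *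
     (c%:P ^+ (e - l) * zx R ^+ l *+ 'C(e, l)) =
   (((-1) ^+ b *+ 'C(j, b) *+ 'C(e, l))%:P * (c ^+ (e - l) * 'X^(b + l))) *:
      'X^(b.*2 + l).
  rewrite -mul_polyC expr1n mul1r (exprNn ('X * _)) /zx !exprMn !exprD -addnn exprD.
  by rewrite !polyCM !polyC_exp !polyCMn !polyC_exp !polyCN !polyC1; ring.
rewrite linearZ /= -['X^(b.*2 + l)]mulr1 lamXnM.
case: ltnP => [_|lej]; first by rewrite mulr0.
rewrite /lam mul1r coef_poly (leq_ltn_trans (leq_subr _ _)) //.
by rewrite !mulrA.
Qed.

Lemma revp_toricT K m j : (j <= m)%N -> (j < K)%N ->
  revp m (toricT K m j) =
  lam K j ((1 - 'X * zx R) ^+ j * ('X%:P + zx R) ^+ (m - j)).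
Proof.
move=> lejm ltjK; rewrite lam_pow_expand // /toricT -polyC1 lam_pow_expand //.
rewrite linear_sum; apply: eq_bigr => b _ /=.
rewrite linear_sum; apply: eq_bigr => l _ /=.
have hl := ltn_ord l.
case: ltnP => [_|lej]; first by rewrite linear0.
rewrite !mul_polyC linearZ /= expr1n mul1r; congr (_ *: _).
(* The reversal degree splits into [u] for the palindromic [sigma] and [m - u] for the power of
   x. *)
set u := (j - (b.*2 + l))%N; have em : m = ((m - u) + u)%N by rewrite /u; lia.
have le_bl : (b + l <= m - u)%N by rewrite /u; lia.
rewrite {1}em revpM ?size_sigma ?size_polyXn // revp_sigma revpXn // -exprD.
by congr ('X^_ * _); rewrite /u; lia.
Qed.
End ToricTerms.

(** * Reversal of powers of x - 1 *)

Lemma revp_exp (R : comNzRingType) k (p : {poly R}) : (size p <= 2)%N ->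
  revp k (p ^+ k) = revp 1 p ^+ k.
Proof.
move=> sp; elim: k => [|k IH]; first by rewrite !expr0 -[1](expr0 'X) revpXn ?subnn.
rewrite !exprS -IH -add1n revpM // (leq_trans (size_poly_exp_leq _ _)) // ltnS.
by rewrite -[leqRHS]mul1n leq_mul // -subn1 leq_subLR.
Qed.

Lemma revp_expXB1 (R : comNzRingType) k :
  revp k (('X - 1 : {poly R}) ^+ k) = (1 - 'X) ^+ k.
Proof.
rewrite revp_exp; last by rewrite -polyC1 size_XsubC.
have rX : revp 1 ('X : {poly R}) = 1.
  exact: (@revpXn R 1 1).
by rewrite linearB /= rX -(expr0 'X) revpXn.
Qed.

Lemma revp_exp1BX (R : comNzRingType) k :
  revp k ((1 - 'X : {poly R}) ^+ k) = ('X - 1) ^+ k.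
Proof.
have -> : (1 - 'X : {poly R}) ^+ k = ((-1) ^+ k)%:P * ('X - 1) ^+ k.
  by rewrite polyC_exp -exprMn polyCN; congr (_ ^+ _); ring.
rewrite mul_polyC linearZ /= revp_expXB1 -mul_polyC polyC_exp -exprMn polyCN.
by congr (_ ^+ _); ring.
Qed.

(** * The closed form of the toric g-polynomial *)

Section DualSimplicialEulerian.
Variables (d : Order.disp_t) (P : finTBPOrderType d) (rho : P -> nat).
Hypotheses (rk : is_rank rho) (eul : eulerian rho) (bool_up : dual_simplicial P).
Implicit Types p q r : P.
(** A common truncation order for all series: the coefficient indices used are at most ranks, hence
    below [K]. *)
Local Notation K := (rho \top%O).+1.

Lemma rank_ltK p : (rho p < K)%N.
Proof. by rewrite ltnS (rank_le rk) ?lex1. Qed.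

Lemma sum_sign (T : comNzRingType) p : p != \bot%O ->
  \sum_(q | (\bot < q <= p)%O) (-1) ^+ rho q = -1 :> T.
Proof.
move=> p0; have bp : (\bot < p)%O by rewrite lt0x.
have /(congr1 (fun x : int => x%:~R : T)) := eul bp.
rewrite rmorph_sum (bigD1 \bot%O) ?lexx ?le0x //= rk.1 expr0 => /eqP.
rewrite addrC addr_eq0 => /eqP e; rewrite -[RHS]e; apply: eq_big => [q|q _].
  by rewrite le0x lt0x andbC.
by rewrite rmorphXn rmorphN1.
Qed.

(* The coefficients are the differences [h_(i-1) - h_i], where
   [h_i = h_(rho p - 1 - i)] is the coefficient of [x ^ i] in
   [\sum_(0 < q <= p) (x - 1) ^ (rho q - 1)] and [(h_i)_i] is the toric
   h-vector of [(0, p]^*]. *)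
Definition diff_h p : {poly rat} := \sum_(q | (\bot < q <= p)%O) ('X - 1) ^+ rho q.

Lemma diff_h0 p : p != \bot%O -> (diff_h p)`_0 = -1.
Proof.
move=> p0; rewrite -(sum_sign rat p0) coef_sum; apply: eq_bigr => q _.
by rewrite coef_expXB1 subn0 bin0.
Qed.

Lemma diff_h_rank p : p != \bot%O -> (diff_h p)`_(rho p) = 1.
Proof.
move=> p0; rewrite coef_sum (bigD1 p) ?lexx ?lt0x ?p0 //=.
rewrite coef_expXB1 subnn binn big1 ?addr0 // => q /andP[/andP[_ qp] nqp].
by rewrite coef_expXB1 bin_small // (rank_lt rk) // lt_neqAle nqp.
Qed.

(** Dehn-Sommerville: expanding x^(rho p - rho q) over the Boolean interval [q, p] and exchanging
    sums leaves, for each r, the Eulerian sum over 0 < q <= r. *)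
Lemma revp_diff_h p : revp (rho p) (diff_h p) = - diff_h p.
Proof.
have rev q : (\bot < q <= p)%O -> revp (rho p) (('X - 1 : {poly rat}) ^+ rho q) =
    \sum_(r | (q <= r <= p)%O) (-1) ^+ rho q * ('X - 1) ^+ rho r.
  rewrite lt0x => /andP[q0 qp].
  have le_qp := rank_le rk qp.
  rewrite -[in LHS](subnK le_qp) -[_ ^+ _]mul1r revpM ?size_poly1 //; last first.
    by rewrite -polyC1 size_exp_XsubC.
  rewrite revp_expXB1 -[in LHS](expr0 'X) revpXn // subn0.
  have eX : 'X = 1 + ('X - 1) :> {poly rat} by ring.
  rewrite {1}eX.
  rewrite -(sum_boolean rk bool_up) // mulr_suml; apply: eq_bigr => r /andP[qr _].
  rewrite expr1n mul1r -[in LHS](subnK (rank_le rk qr)) addnK.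
  rewrite -[in RHS](subnK (rank_le rk qr)) [in RHS]exprD.
  have -> : 1 - 'X = -1 * ('X - 1) :> {poly rat} by ring.
  by rewrite exprMn; ring.
rewrite linear_sum (eq_bigr _ rev) /= -sumrN.
rewrite (exchange_big_dep (fun r => (\bot < r <= p)%O)) /=; last first.
  by move=> q r /andP[q0 _] /andP[qr ->]; rewrite (lt_le_trans q0).
apply: eq_bigr => r /andP[r0 rp]; rewrite -mulr_suml -[RHS]mulN1r; congr (_ * _).
rewrite -[RHS](@sum_sign _ r) -?lt0x //; apply: eq_bigl => q.
rewrite rp andbT; case: (boolP (q <= r)%O) => [qr|]; last by rewrite !andbF.
by rewrite (le_trans qr rp) !andbT.
Qed.

Definition closed_g p : {poly rat} :=
  1 - \sum_(1 <= i < rho p) (diff_h p)`_i *: narayana rat (rho p - 1 - i) i.-1.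

Lemma closed_g_bot : closed_g \bot%O = 1.
Proof. by rewrite /closed_g rk.1 big_geq // subr0. Qed.

Lemma size_closed_g p : (size (closed_g p) <= (rho p).-1./2.+1)%N.
Proof.
rewrite /closed_g (leq_trans (size_polyD _ _)) // geq_max size_poly1 size_polyN /=.
apply: (leq_trans (size_sum _ _ _)); apply/bigmax_leqP_seq => i.
rewrite mem_index_iota => lei _.
(* The degree is at most the minimum of rho p - 1 - i and i, hence at most half their sum. *)
rewrite (leq_trans (size_scale_leq _ _)) // (leq_trans (size_narayana _ _ _)) //.
by rewrite ltnS; lia.
Qed.

(** Extending the sum of [closed_g] to i = 0 and i = rho p, where [diff_h] has coefficients -1 and
    1, adds only -1 and -x (1 - x)^(rho p - 1). *)
Lemma closed_gE p : p != \bot%O ->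
  closed_g p = - 'X * (1 - 'X) ^+ (rho p).-1
               - \sum_(q | (\bot < q <= p)%O) toricT rat K (rho p) (rho q).
Proof.
move=> p0; pose L i : {poly rat} :=
  lam K i ((1 + 'X) ^+ i * (1 + zx rat) ^+ (rho p - i)).
have -> : \sum_(q | (\bot < q <= p)%O) toricT rat K (rho p) (rho q) =
    \sum_(i < (rho p).+1) ((diff_h p)`_i)%:P * L i.
  have expand q : (\bot < q <= p)%O -> toricT rat K (rho p) (rho q) =
      \sum_(i < (rho p).+1) ((('X - 1) ^+ rho q)`_i)%:P * L i.
    by move=> /andP[_ qp]; rewrite toricT_expand ?rank_ltK ?(rank_le rk).
  rewrite (eq_bigr _ expand) exchange_big /=; apply: eq_bigr => i _.
  by rewrite -mulr_suml -rmorph_sum coef_sum.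
have := rank_ltK p; rewrite /closed_g {}/L; move: (diff_h0 p0) (diff_h_rank p0).
have := rank_gt0 rk p; rewrite p0; case: (rho p) => [|m] //.
move=> _ d0 dm ltmK.
rewrite big_ord_recl big_ord_recr /= d0 dm.
rewrite expr0 mul1r lam0 // subnn expr0 mulr1 lam_diag // polyCN polyC1.
rewrite big_add1 big_mkord /=.
have -> : \sum_(i < m) (diff_h p)`_i.+1 *: narayana rat (m.+1 - 1 - i.+1) i =
   \sum_(i < m) ((diff_h p)`_(bump 0 i))%:P * lam K (bump 0 i)
        ((1 + 'X) ^+ bump 0 i * (1 + zx rat) ^+ (m.+1 - bump 0 i)).
  apply: eq_bigr => i _; rewrite -mul_polyC /bump add1n; congr (_ * _).
  (* Multiplying and dividing by (1 + z)(1 + x z) raises both exponents by one. *)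
  rewrite /narayana -(lam_cancel (K := K)); last first.
    by rewrite (leq_trans _ ltmK) // !ltnS ltnW.
  congr lam; rewrite !subSS subn0 -(subnSK (ltn_ord i)) !exprS.
  by ring.
by ring.
Qed.

Lemma revp_closed_g p : p != \bot%O ->
  \sum_(r | (r <= p)%O) closed_g r * ('X - 1) ^+ (rho p - rho r) =
  revp (rho p) (closed_g p).
Proof.
move=> p0; have p_gt0 : (0 < rho p)%N by rewrite (rank_gt0 rk).
rewrite (bigD1 \bot%O) ?le0x //= closed_g_bot rk.1 subn0 mul1r.
(* The explicit part depends on r only through the sign (-1)^(rho r), which the Eulerian relation
   sums. *)
have split_g r : (r <= p)%O && (r != \bot)%O ->
    closed_g r * ('X - 1) ^+ (rho p - rho r) =
    'X * ('X - 1) ^+ (rho p).-1 * (-1) ^+ rho r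
    - \sum_(q | (\bot < q <= r)%O) ('X - 1) ^+ (rho p - rho r) * toricT rat K (rho r) (rho q).
  move=> /andP[rp r0]; rewrite closed_gE // mulrBl mulr_suml; congr (_ - _); last first.
    by apply: eq_bigr => q _; rewrite mulrC.
  have := rank_le rk rp; have := rank_gt0 rk r; rewrite r0.
  move: (rho r) (rho p) => [|a] [|b] //= _ leab.
  have [c ->] : exists c, b = (c + a)%N by exists (b - a)%N; lia.
  have -> : 1 - 'X = -1 * ('X - 1) :> {poly rat} by ring.
  by rewrite subSS addnK exprD exprMn exprS; ring.
rewrite (eq_bigr _ split_g) sumrB -mulr_sumr.
have -> : \sum_(r | (r <= p)%O && (r != \bot)%O) (-1) ^+ rho r = -1 :> {poly rat}.
  by rewrite -[RHS](sum_sign _ p0); apply: eq_bigl => r; rewrite lt0x andbC.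
rewrite (exchange_big_dep (fun q => (\bot < q <= p)%O)) /=; last first.
  by move=> r q /andP[rp _] /andP[-> qr]; rewrite (le_trans qr).
have sumT q : (\bot < q <= p)%O ->
    \sum_(r | ((r <= p)%O && (r != \bot)%O) && (\bot < q <= r)%O)
      ('X - 1) ^+ (rho p - rho r) * toricT rat K (rho r) (rho q) =
    revp (rho p) (toricT rat K (rho p) (rho q)).
  move=> /andP[q0 qp]; rewrite revp_toricT ?rank_ltK ?(rank_le rk) //.
  (* The reversed base x + x z is w + (x - 1), so summing over r in [q, p] yields its power. *)
  have -> : 'X%:P + zx rat = ('X - 1)%:P + (1 + zx rat) by rewrite polyCB polyC1; ring.
  rewrite -(sum_boolean rk bool_up) -?lt0x // mulr_sumr linear_sum /=.
  apply: eq_big => [r|r /andP[_ /andP[_ qr]]].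
    rewrite q0 /= andbAC andbC; case: (boolP (q <= r)%O) => /= qr; last by rewrite !andbF.
    by rewrite -lt0x (lt_le_trans q0 qr) andbT.
  by rewrite -polyC_exp mulrCA mul_polyC linearZ.
rewrite (eq_bigr _ sumT) closed_gE // linearB (linear_sum (revp (rho p))) /=.
have -> : revp (rho p) (- 'X * (1 - 'X) ^+ (rho p).-1) =
          - ('X - 1) ^+ (rho p).-1 :> {poly rat}.
  rewrite -[X in revp X](prednK p_gt0) -add1n revpM ?size_polyN ?size_polyX //.
    rewrite revp_exp1BX linearN /= (_ : revp 1 'X = 1) ?mulN1r //.
    exact: (@revpXn _ 1 1).
  rewrite -opprB exprNn -signr_odd; case: odd; rewrite ?expr1 ?expr0 ?mul1r ?mulN1r ?size_polyN;
    by rewrite -polyC1 size_exp_XsubC.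
rewrite addrA; congr (_ - _).
by rewrite -[in X in X + _](prednK p_gt0) exprS; ring.
Qed.

Lemma toric_g_closed p : toric_g rho p = closed_g p.
Proof.
have [k] := ubnP (rho p); elim: k p => // k IH p ltpk.
have [->|p0] := eqVneq p \bot%O; first by rewrite toric_g0 closed_g_bot.
rewrite toric_gE //; apply: (g_of_f_uniq (R := revp (rho p) (closed_g p))).
- rewrite -revp_closed_g // (bigD1 p) //= subnn expr0 mulr1 opprD addrA subrr add0r.
  rewrite /toric_f (negPf p0) mulr_sumr -sumrN; apply: eq_big => [q|q qp].
    by rewrite lt_neqAle andbC.
  have rqp := rank_lt rk qp.
  rewrite IH; last by lia.
  have -> : (rho p - rho q = (rho p - 1 - rho q).+1)%N by lia.
  by rewrite exprS; ring.
- exact: size_closed_g.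
- move=> i lei; have p_gt0 : (0 < rho p)%N by rewrite (rank_gt0 rk).
  (* For i <= (rho p - 1) / 2, the index rho p - i exceeds the degree of [closed_g p]. *)
  rewrite coef_poly; case: ifP => // _; rewrite nth_default //.
  by rewrite (leq_trans (size_closed_g _)) //; lia.
Qed.

(** * The toric h-vector of the dual *)

(** The dual interval below q is Boolean, so (1 - x) f is 1 minus a power of x beyond the cut. *)
Lemma toric_g_dual (q : P^d) : (q : P) != \bot%O -> toric_g (dual_rank rho) q = 1.
Proof.
have rkd := is_rank_dual rk.
have [k] := ubnP (dual_rank rho q); elim: k q => // k IH q ltqk q0.
have [->|q1] := eqVneq q (\bot%O : P^d); first by rewrite toric_g0.
rewrite toric_gE //; apply: (g_of_f_uniq (R := 'X^(dual_rank rho q))).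
- have -> : 'X^(dual_rank rho q) =
      1 + \sum_(r : P^d | (r < q)%O) ('X - 1) ^+ (dual_rank rho q - dual_rank rho r)
      :> {poly rat}.
    have lerk r : (rho r <= rho \top%O)%N by rewrite (rank_le rk) ?lex1.
    have := sum_boolean rk bool_up (1 : {poly rat}) ('X - 1) q0 (lex1 (q : P)).
    rewrite (addrC 1) subrK => <-; rewrite (bigD1 (q : P)) ?lexx ?lex1 //=.
    rewrite subnn expr0 mulr1 expr1n; congr (_ + _); apply: eq_big => [r|r _].
      by rewrite lex1 andbT -[RHS]/(_ < (r : P))%O [RHS]lt_neqAle andbC eq_sym.
    rewrite expr1n mul1r; congr (_ ^+ _); rewrite /dual_rank.
    by have := lerk r; have := lerk q; lia.
  rewrite /toric_f (negPf q1) mulr_sumr opprD addrA subrr add0r -sumrN.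
  apply: eq_bigr => r rq; have lt_rq := rank_lt rkd rq.
  have r0 : (r : P) != \bot%O.
    rewrite -lt0x; apply: (@lt_trans _ _ (q : P)); by rewrite ?lt0x.
  rewrite IH ?mul1r //; last by lia.
  have -> : (dual_rank rho q - dual_rank rho r =
             (dual_rank rho q - 1 - dual_rank rho r).+1)%N by lia.
  by rewrite exprS; ring.
- by rewrite size_poly1.
- move=> i lei; rewrite coefXn; case: eqP => // ei.
  by have := rank_gt0 rkd q; rewrite q1; lia.
Qed.

Lemma toric_f_dual : (\bot < \top :> P)%O ->
  toric_f (dual_rank rho) (\top%O : P^d) =
  \sum_(q : P | (\bot < q)%O) ('X - 1) ^+ (rho q).-1.
Proof.
move=> bt; rewrite /toric_f ifF; last first.
  by apply/negbTE; have := gt_eqF bt; rewrite eq_sym => ->.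
apply: eq_bigr => q lt_q; have q0 : (\bot < (q : P))%O by [].
rewrite toric_g_dual -?lt0x // mul1r.
congr (_ ^+ _); rewrite /dual_rank [rho (\top : P^d)%O]rk.1.
have := rank_le rk (lex1 (q : P)); have := rank_gt0 rk (q : P); rewrite -lt0x q0.
by lia.
Qed.

(** As [toric_h] reads f backwards, multiplying f by x - 1 puts h_i - h_(i-1) at index n + 1 - i. *)
Lemma toric_h_dual n i : rho \top%O = n.+1 -> (i <= n)%N ->
  toric_h (dual_rank rho) i - (if i is j.+1 then toric_h (dual_rank rho) j else 0)
    = (diff_h \top%O)`_(n.+1 - i).
Proof.
move=> rkn lein.
have bt : (\bot < \top :> P)%O by rewrite lt0x -(rank_gt0 rk) rkn.
have en : (dual_rank rho \top%O).-1 = n by rewrite /dual_rank [rho (\top : P^d)%O]rk.1 rkn.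
set F := toric_f (dual_rank rho) (\top%O : P^d).
have F_diff : diff_h \top%O = ('X - 1) * F.
  rewrite /F toric_f_dual // mulr_sumr; apply: eq_big => [q|q /andP[q0 _]].
    by rewrite lex1 andbT.
  by rewrite -exprS prednK // (rank_gt0 rk) -lt0x.
(* This covers i = 0, where h_(-1) is read as 0. *)
have Fn : F`_n.+1 = 0.
  rewrite nth_default //; apply: leq_trans (size_toric_f (is_rank_dual rk) _) _.
    by have := gt_eqF bt; rewrite eq_sym => ->.
  by rewrite -[in leqRHS]en; case: dual_rank.
rewrite F_diff mulrBl mul1r coefB coefXM subSn //= /toric_h en lein -/F.
case: i lein => [|i] lein; first by rewrite subn0 Fn.
by rewrite (ltnW lein) subnSK.
Qed.

Lemma diff_h_sym p i : (i <= rho p)%N -> (diff_h p)`_(rho p - i) = - (diff_h p)`_i.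
Proof. by move=> lei; rewrite -coefN -revp_diff_h coef_poly ltnS lei. Qed.
End DualSimplicialEulerian.

(** * Folding the sum and assembling the formula *)

(** The reflection of i to n + 1 - i pairs the two halves; its fixed index, present only for odd n,
    contributes nothing. *)
Lemma sum_fold (V : zmodType) (F : nat -> V) n :
  (forall i, i.*2 = n.+1 -> F i = 0) ->
  \sum_(1 <= i < n.+1) F i = \sum_(1 <= i < n./2.+1) (F i + F (n.+1 - i)%N).
Proof.
move=> Fmid; rewrite big_split /= (big_cat_nat _ (n := n./2.+1)) /=; try lia.
congr (_ + _); rewrite (big_cat_nat _ (n := (n - n./2).+1)) /=; try lia.
rewrite big_nat big1 ?add0r => [|i lei]; last by apply: Fmid; lia.
rewrite -[(n - n./2).+1]add0n big_addn [RHS]big_add1 /= [RHS]big_nat_rev /=.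
have -> : (n.+1 - (n - n./2).+1 = n./2)%N by lia.
by rewrite !big_nat; apply: eq_bigr => i lei; congr F; lia.
Qed.

(* The coefficient identity is
   [C(a,k) C(b,k-1) - C(b,k) C(a,k-1) = (a - b) / k * C(a,k-1) C(b,k-1)]. *)
Lemma narayanaB a b m : (minn a b < m)%N ->
  narayana rat a b - narayana rat b a =
  \sum_(1 <= k < m.+1) ((a%:R - b%:R) / k%:R * 'C(a, k.-1)%:R * 'C(b, k.-1)%:R) *: 'X^k.
Proof.
have mul_bin c k : k.+1%:R * 'C(c, k.+1)%:R = (c%:R - k%:R) * 'C(c, k)%:R :> rat.
  rewrite -natrM mul_bin_left natrM; have [lekc|ltck] := leqP k c.
    by rewrite natrB.
  by rewrite bin_small // !mulr0.
move=> ltm; apply/polyP=> k; rewrite coefB !coef_narayana coef_sum.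
under eq_bigr do rewrite coefZ coefXn.
have [lek|ltk] := boolP (1 <= k < m.+1)%N; last first.
  rewrite big_nat big1 => [|i lei]; last first.
    by case: eqP => [eki|]; rewrite ?mulr0 //; move: ltk; rewrite eki lei.
  case: k ltk => [|k] ltk; first by rewrite subr0.
  have : (a < k)%N || (b < k)%N by lia.
  have bin0k c : (c < k)%N -> 'C(c, k) = 0%N /\ 'C(c, k.+1) = 0%N.
    by move=> ltck; rewrite !bin_small // ltnW.
  by case/orP=> /bin0k[-> ->]; rewrite !(muln0, mul0n) subrr.
rewrite (bigD1_seq k) ?mem_index_iota ?iota_uniq //= eqxx mulr1 big1 ?addr0; last first.
  by move=> i; rewrite eq_sym => /negbTE->; rewrite mulr0.
case: k lek => // k _ /=; have k0 : k.+1%:R != 0 :> rat by rewrite pnatr_eq0.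
apply: (mulfI k0); rewrite !natrM.
transitivity (k.+1%:R * 'C(a, k.+1)%:R * 'C(b, k)%:R
              - k.+1%:R * 'C(b, k.+1)%:R * 'C(a, k)%:R : rat); first by ring.
by rewrite !mul_bin; field; rewrite nat1r.
Qed.

Theorem corollary6p9 (d : Order.disp_t) (P : finTBPOrderType d)
    (rho : P -> nat) (n : nat) :
  is_rank rho -> eulerian rho -> dual_simplicial P ->
  rho \top%O = n.+1 ->
  let h : nat -> rat := toric_h (dual_rank rho) in
  toric_g rho \top%O =
    (h 0%N)%:P +
    \sum_(1 <= i < (n./2).+1)
      (h i - h i.-1) *:
        \sum_(1 <= k < (minn i (n - i)).+1)
          ((n.+1%:R - (2 * i)%:R) / k%:R
             * ('C(n - i, k.-1))%:R * ('C(i.-1, k.-1))%:R) *: 'X^k.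
Proof.
move=> rk eul bool_up rkn /=.
have t0 : \top%O != \bot%O :> P by rewrite -(rank_gt0 rk) rkn.
rewrite (toric_g_closed rk eul bool_up) /closed_g rkn.
have h0 : toric_h (dual_rank rho) 0 = 1.
  have := toric_h_dual rk bool_up rkn (leq0n n).
  by rewrite subr0 subn0 -rkn (diff_h_rank rk t0).
have d_sym i : (i <= n.+1)%N ->
    (diff_h rho \top%O)`_(n.+1 - i) = - (diff_h rho \top%O)`_i.
  by rewrite -rkn; apply: diff_h_sym.
rewrite h0 polyC1 sum_fold => [|i ei]; last first.
  (* At the fixed index d_i = - d_i, so d_i = 0. *)
  have := d_sym i; have -> : (n.+1 - i = i)%N by lia.
  move=> /(_ _)/eqP; rewrite -addr_eq0 -mulr2n mulrn_eq0 /= => /(_ _)/eqP->.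
    by rewrite scale0r.
  by lia.
congr (_ + _); rewrite -sumrN !big_nat; apply: eq_bigr => i lei.
have := toric_h_dual (i := i) rk bool_up rkn.
case: i lei => // i lei /= ->; last by lia.
(* Paired terms have opposite coefficients and swapped [narayana] arguments, so [narayanaB] combines
   them. *)
rewrite d_sym ?[in X in _ + X]d_sym; try lia.
have -> : (n.+1 - 1 - i.+1 = n - i.+1)%N by lia.
have -> : (n.+1 - 1 - (n.+1 - i.+1) = i)%N by lia.
have -> : ((n.+1 - i.+1).-1 = n - i.+1)%N by lia.
rewrite !scaleNr -scalerBr (@narayanaB _ _ (minn i.+1 (n - i.+1))); last by lia.
congr (- (_ *: _)); apply: eq_bigr => k _.
have -> : n.+1%:R - (2 * i.+1)%:R = (n - i.+1)%:R - i%:R :> rat.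
  rewrite natrB; last by lia.
  by rewrite natrM -[n.+1]addn1 -[i.+1]addn1 !natrD; ring.
by [].
Qed.
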